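(* Let $1\le k\le n$ and let $\mathcal{V}_{k,n}=\{Z\in\mathbb{C}^{n\times k}: Z^TZ=\mathrm{Id}_k\}$ be the (complex) Stiefel manifold. Then $\mathcal V_{k,n}$ has dimension $$\dim(\mathcal V_{k,n})=nk-\binom{k+1}{2}=\binom{n}{2}-\binom{n-k}{2}.$$ The Stiefel ideal $I_{\mathrm{St}}=I(\mathcal V_{k,n})$ equals $\langle Z^TZ-\mathrm{Id}_k\rangle$ and is a complete intersection. When $k<n$, $\mathcal V_{k,n}$ is irreducible and $I_{\mathrm{St}}$ is prime.
   Context: $\mathcal V_{k,n}$ is regarded as an affine algebraic variety in $\mathbb{A}^{nk}$ over $\mathbb{C}$. $I(\mathcal V_{k,n})$ is the ideal of all polynomials in $\mathbb{C}[Z]$ (the $nk$ entries of $Z$ being variables) vanishing on $\mathcal V_{k,n}$, and $\langle Z^TZ-\mathrm{Id}_k\rangle$ is the ideal generated by the entries of the symmetric $k\times k$ matrix $Z^TZ-\mathrm{Id}_k$ (so by $\binom{k+1}{2}$ polynomials). *)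

(* Defs.v *)
From HB Require Import structures.
From mathcomp Require Import all_boot all_order all_algebra.
From mathcomp Require Import complex.
From mathcomp Require Import boolp classical_sets reals.
From mathcomp Require Import mpoly.

Set Implicit Arguments.
Unset Strict Implicit.
Unset Printing Implicit Defensive.

Import Order.TTheory GRing.Theory Num.Theory.
Local Open Scope classical_set_scope.
Local Open Scope ring_scope.

Definition ideal_span (A : comNzRingType) (S : set A) : set A :=
  [set p | exists r (a g : 'I_r -> A),
     (forall i, S (g i)) /\ p = \sum_(i < r) a i * g i].

(* [idealr_closed] contains the properness condition 1 \notin I *)
Definition prime_ideal (A : comNzRingType) (I : set A) : Prop :=
  idealr_closed (fun p : A => p \in I) /\
  prime_idealr_closed (fun p : A => p \in I).

Section AffineVarieties.
Variables (K : closedFieldType) (m : nat).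
Implicit Types (V Y : set 'rV[K]_m) (S J : set {mpoly K[m]}).

Definition zero_locus S : set 'rV[K]_m :=
  [set x | forall p, S p -> p.@[x ord0] = 0].

Definition vanishing_ideal V : set {mpoly K[m]} :=
  [set p | forall x, V x -> p.@[x ord0] = 0].

Definition algebraic V : Prop := exists S, V = zero_locus S.

Definition irreducible Y : Prop :=
  [/\ algebraic Y, Y !=set0 &
      forall Y1 Y2, algebraic Y1 -> algebraic Y2 ->
        Y = Y1 `|` Y2 -> Y = Y1 \/ Y = Y2].

(* Only the values of W at 0, ..., d matter. *)
Definition irreducible_chain V (d : nat) (W : nat -> set 'rV[K]_m) : Prop :=
  (forall i, (i <= d)%N -> irreducible (W i) /\ W i `<=` V) /\
  (forall i, (i < d)%N -> W i `<` W i.+1).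

(* For algebraic V, this is the Krull dimension of V with its Zariski topology:
   the irreducible closed subsets of V are the irreducible algebraic sets
   contained in V. The empty set has no dimension. *)
Definition has_dim V (d : nat) : Prop :=
  (exists W, irreducible_chain V d W) /\
  (forall e W, irreducible_chain V e W -> (e <= d)%N).

(* J is generated by as many polynomials as its codimension m - d. *)
Definition complete_intersection J : Prop :=
  exists r d (f : 'I_r -> {mpoly K[m]}),
    [/\ J = ideal_span (range f), has_dim (zero_locus J) d & (r + d = m)%N].

End AffineVarieties.

Section Stiefel.
Variables (K : closedFieldType) (k n : nat).

(* n x k matrices are points of affine (n * k)-space through [mxvec]/[vec_mx];
   [generic_matrix] is the matrix of the corresponding coordinates. *)
Definition stiefel : set 'rV[K]_(n * k) :=
  [set x | (vec_mx x : 'M[K]_(n, k))^T *m vec_mx x = 1%:M].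

Definition generic_matrix : 'M[{mpoly K[n * k]}]_(n, k) :=
  \matrix_(i < n, j < k) 'X_(mxvec_index i j).

Definition stiefel_equations : set {mpoly K[n * k]} :=
  [set p | exists i j : 'I_k,
     p = (generic_matrix^T *m generic_matrix - 1%:M) i j].

End Stiefel.

Arguments stiefel : clear implicits.
Arguments generic_matrix : clear implicits.
Arguments stiefel_equations : clear implicits.

(* Main.v *)
Require Import Defs.
From HB Require Import structures.
From mathcomp Require Import all_boot all_order all_algebra.
From mathcomp Require Import complex.
From mathcomp Require Import boolp classical_sets reals.
From mathcomp Require Import mpoly.
From mathcomp Require Import perm ring zify.

Set Implicit Arguments.
Unset Strict Implicit.
Unset Printing Implicit Defensive.

Import Order.TTheory GRing.Theory Num.Theory.
Local Open Scope classical_set_scope.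
Local Open Scope ring_scope.

(** The Cayley transform parametrizes the Stiefel variety rationally. Write [n = k + l]
    and split [Z] into its top square block [X] and its bottom block [Y]. Where
    [det (1 + X)] is invertible, [Z^T Z = 1] holds exactly when [X = 2P - 1] and
    [Y = - 2BP] with [P] inverse to [1 + H + B^T B], [H] skew and [B] arbitrary
    ([cayley_stiefel], [inv_cayley]). The pairs [(H, B)] form an affine space of dimension
    [n k - 'C(k + 1, 2)]. Changing the signs of some of the top rows preserves the variety
    and moves this chart around, and the [2 ^ k] charts so obtained cover everything, for
    a strong reason: the polynomials [det (1 + D X)], with [D] a diagonal sign matrix, add
    up to the constant [2 ^ k] ([sum_det_flip]). All of this is valid over any
    commutative ring in which 2 is invertible, and each claim follows from it.

    Ideal. A polynomial [p] vanishing on the variety vanishes on each chart as a rational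
    function, hence at every ring-valued solution of the equations at which
    [det (1 + D X)] is invertible. Taking the universal such solution, some power of
    [det (1 + D X)] multiplies [p] into the ideal of the equations
    ([localization_principle]), and since these determinants generate the unit ideal, [p]
    itself lies there ([stiefel_ideal]).

    Dimension. On a chart with [d] variables any [d + 1] polynomials are algebraically
    dependent ([rat_image_dependent]), while a chain of primes yields as many independent
    polynomials as it has steps ([chain_independent]); this bounds the length of chains
    of irreducible closed subsets by [d]. Conversely the closures of the images of a
    coordinate flag under one chart form a chain of length [d] ([chain_exists]). The
    number of equations [z_i . z_j = delta_ij] with [j <= i] is [n k - d], so the
    intersection is complete.

    Irreducibility. The closure of a chart is irreducible. If [k < n], two charts whose
    signs differ in a single place have a common point ([common_point]), so all charts
    have the same closure, which is the whole variety. *)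

(** * Evaluation of multivariate polynomials *)

Section Evaluation.
Variables (K : comNzRingType) (n : nat).

Lemma rmorph_mmap (C C' : comNzRingType) (g : {rmorphism C -> C'})
    (iota : {rmorphism K -> C}) (h : 'I_n -> C) (p : {mpoly K[n]}) :
  g (mmap iota h p) = mmap (g \o iota) (g \o h) p.
Proof.
rewrite /mmap rmorph_sum; apply: eq_bigr => m _.
by rewrite rmorphM rmorph_prod; congr (_ * _); apply: eq_bigr => i _; rewrite rmorphXn.
Qed.

Lemma eq_mmap (C : comNzRingType) (f f' : K -> C) (h h' : 'I_n -> C) (p : {mpoly K[n]}) :
  f =1 f' -> h =1 h' -> mmap f h p = mmap f' h' p.
Proof.
move=> ef eh; rewrite /mmap; apply: eq_bigr => m _; rewrite ef.
by congr (_ * _); apply: eq_bigr => i _; rewrite eh.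
Qed.

Lemma mmap_id (p : {mpoly K[n]}) : mmap (@mpolyC n K) (fun i => 'X_i) p = p.
Proof.
rewrite [RHS]mpolyE /mmap; apply: eq_bigr => m _.
by rewrite mul_mpolyC mmap1_id.
Qed.

End Evaluation.

Lemma mmap_comp (K : comNzRingType) n m (C : comNzRingType)
    (iota : {rmorphism K -> C}) (h : 'I_n -> C) (u : 'I_m -> {mpoly K[n]}) (p : {mpoly K[m]}) :
  mmap iota h (mmap (@mpolyC n K) u p) = mmap iota (fun i => mmap iota h (u i)) p.
Proof.
by rewrite (rmorph_mmap (mmap iota h)); apply: eq_mmap => // c /=; rewrite mmapC.
Qed.

(** Evaluation in one variable at a time, the last one first; this is what makes
    inductions on the number of variables possible. *)
Lemma mmap_muni (K : comNzRingType) n (C : comNzRingType) (iota : {rmorphism K -> C})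
    (h : 'I_n.+1 -> C) (p : {mpoly K[n.+1]}) :
  mmap iota h p =
  (map_poly (mmap iota (fun i => h (widen_ord (leqnSn n) i))) (muni p)).[h ord_max].
Proof.
rewrite muniE rmorph_sum horner_sum /mmap; apply: eq_bigr => m _.
rewrite /= -mul_polyC rmorphM /= map_polyC map_polyXn hornerM hornerC hornerXn /=.
rewrite mmapZ mmapX /mmap1 big_ord_recr /= mulrA; congr (_ * _ * _).
by apply: eq_bigr => i _; rewrite mnmE.
Qed.

Lemma muni_eq0 (K : comNzRingType) n (p : {mpoly K[n.+1]}) : muni p = 0 -> p = 0.
Proof.
by move=> p0; rewrite -[p]mmap_id mmap_muni p0 rmorph0 horner0.
Qed.

Lemma mpoly0_const (K : nzRingType) (p : {mpoly K[0]}) : p = (p@_0%MM)%:MP.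
Proof.
apply/mpolyP => m; have -> : m = 0%MM by apply/mnmP => -[].
by rewrite mcoeffC eqxx mulr1.
Qed.

Section InfiniteField.
Variable K : idomainType.
Hypothesis natr_inj : injective (fun m : nat => m%:R : K).

Lemma poly_vanishes (p : {poly K}) : (forall c, p.[c] = 0) -> p = 0.
Proof.
move=> p0; apply/eqP; apply/negPn/negP => pn0.
have := @max_poly_roots _ p [seq (i%:R : K) | i <- iota 0 (size p)] pn0.
rewrite size_map size_iota ltnn; case/(_ _ _)/notF => //.
- by apply/allP => x /mapP[i _ ->]; rewrite /root p0.
- by rewrite map_inj_uniq ?iota_uniq.
Qed.

(** Freeze all variables but the last: a polynomial in one variable has too few roots
    for the infinitely many multiples of 1, so each coefficient vanishes identically. *)
Lemma mpoly_vanishes n (p : {mpoly K[n]}) : (forall v, p.@[v] = 0) -> p = 0.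
Proof.
elim: n p => [|n IH] p p0.
  by have := p0 (fun=> 0); rewrite (mpoly0_const p) mevalC => ->.
apply: muni_eq0; apply/polyP => j; rewrite coef0; apply: IH => v.
rewrite /meval -[LHS](@coef_map _ _ (mmap (@idfun K) v)) /=.
set q := map_poly _ _; suff -> : q = 0 by rewrite coef0.
apply: poly_vanishes => c.
pose w (i : 'I_n.+1) := if insub (val i) is Some j then v j else c : K.
have := p0 w; rewrite /meval (mmap_muni (@idfun K)) => <-.
have -> : w ord_max = c by rewrite /w insubN //= -leqNgt.
congr horner; apply: eq_map_poly => r; apply: eq_mmap => // i.
by rewrite /w /= valK.
Qed.

End InfiniteField.

(** * Clearing denominators *)

Section Pullback.
Variables (K : comNzRingType) (d N : nat) (D : {mpoly K[d]}) (u : 'I_N -> {mpoly K[d]}).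

(** The polynomial [D ^+ msize p * p(u / D)]: each monomial of [p] has degree at most
    [msize p], so this power of [D] clears all denominators. *)
Definition pullback (p : {mpoly K[N]}) : {mpoly K[d]} :=
  \sum_(m <- msupp p) p@_m *: (D ^+ (msize p - mdeg m) * \prod_i u i ^+ m i).

(** Stated for points over an arbitrary commutative algebra in which [D] becomes
    invertible: it is used both at points of the ground field and at the generic
    point of a localized quotient ring. *)
Lemma mmap_pullback (C : comNzRingType) (iota : {rmorphism K -> C}) (x : 'I_d -> C)
    (w : C) (p : {mpoly K[N]}) :
  w * mmap iota x D = 1 ->
  mmap iota x (pullback p) =
  mmap iota x D ^+ msize p * mmap iota (fun i => w * mmap iota x (u i)) p.
Proof.
move=> wD; rewrite /pullback rmorph_sum /=.
pose y i := w * mmap iota x (u i).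
rewrite -/y [in RHS]/(mmap iota y) mulr_sumr.
rewrite big_seq [in RHS]big_seq; apply: eq_bigr => m /msize_mdeg_lt /ltnW mp.
rewrite mmapZ rmorphM rmorphXn rmorph_prod /= [in RHS]mulrCA; congr (_ * _).
have -> : mmap1 y m = w ^+ mdeg m * \prod_i mmap iota x (u i ^+ m i).
  by rewrite mdegE -prodrXr -big_split; apply: eq_bigr => i _; rewrite exprMn rmorphXn.
rewrite -{2}(subnK mp) exprD mulrA -[_ * _ * w ^+ _]mulrA -exprMn [_ * w]mulrC wD.
by rewrite expr1n mulr1.
Qed.

End Pullback.

(** * Irreducible algebraic sets and prime ideals *)

Section PrimeIdeals.
Variable A : comNzRingType.
Implicit Type I : set A.

Lemma prime_idealP I :
  prime_ideal I <->
  [/\ I 0, ~ I 1, forall p q, I p -> I q -> I (p + q),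
      forall a p, I p -> I (a * p) & forall p q, I (p * q) -> I p \/ I q].
Proof.
split=> [[[I0 I1 IDM] IP]|[I0 I1 ID IM IP]].
  have memI p : (p \in (fun p : A => p \in I)) = `[< I p >] by [].
  rewrite !memI in I0 I1.
  split=> [||p q Ip Iq|a p Ip|p q Ipq].
  - exact/asboolP.
  - by move=> J1; case/negP: I1; apply/asboolP.
  - by apply/asboolP; have := IDM 1 p q; rewrite !memI mul1r; apply; apply/asboolP.
  - apply/asboolP; have := IDM a p 0; rewrite !memI addr0; apply; last by [].
    exact/asboolP.
  - have := IP p q; rewrite !memI => /(_ (introT (asboolP _) Ipq)).
    by case/orP => /asboolP; [left|right].
split; first split.
- by apply/asboolP.
- by apply/negP => /asboolP.
- by move=> a p q /asboolP Ip /asboolP Iq; apply/asboolP/ID => //; apply: IM.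
- by move=> p q /asboolP/IP[] ?; apply/orP; [left|right]; apply/asboolP.
Qed.

End PrimeIdeals.

Section Varieties.
Variables (K : closedFieldType) (m : nat).
Implicit Types (V Y : set 'rV[K]_m).

Definition zariski_closure Y := zero_locus (vanishing_ideal Y).

Lemma sub_closure Y : Y `<=` zariski_closure Y.
Proof. by move=> y Yy p; apply. Qed.

Lemma vanishing_idealS Y1 Y2 : Y1 `<=` Y2 -> vanishing_ideal Y2 `<=` vanishing_ideal Y1.
Proof. by move=> s p Ip y /s /Ip. Qed.

Lemma closure_algebraic Y : algebraic (zariski_closure Y).
Proof. by exists (vanishing_ideal Y). Qed.

Lemma algebraic_closure V : algebraic V -> zariski_closure V = V.
Proof.
case=> S ->; apply/seteqP; split; last exact: sub_closure.
by move=> x Vx p Sp; apply: Vx => y; apply.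
Qed.

Lemma closure_min Y V : algebraic V -> Y `<=` V -> zariski_closure Y `<=` V.
Proof.
move=> /algebraic_closure VE YV x Yx; rewrite -VE => p Ip.
by apply: Yx => y /YV /Ip.
Qed.

Lemma vanishing_closure Y : vanishing_ideal (zariski_closure Y) = vanishing_ideal Y.
Proof.
apply/seteqP; split; first exact/vanishing_idealS/sub_closure.
by move=> p Ip y; apply.
Qed.

Lemma algebraicI V (p : {mpoly K[m]}) :
  algebraic V -> algebraic (V `&` [set x | p.@[x ord0] = 0]).
Proof.
case=> S ->; exists (S `|` [set p]); apply/seteqP; split=> x.
  by move=> [Sx px] q [/Sx|->].
by move=> Sx; split=> [q Sq|]; apply: Sx; [left|right].
Qed.

Lemma vanishing_ideal0 Y : vanishing_ideal Y 0.
Proof. by move=> x _; rewrite meval0. Qed.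

Lemma vanishing_idealD Y p q :
  vanishing_ideal Y p -> vanishing_ideal Y q -> vanishing_ideal Y (p + q).
Proof. by move=> Ip Iq x Yx; rewrite mevalD Ip ?Iq ?addr0. Qed.

Lemma vanishing_idealM Y a p : vanishing_ideal Y p -> vanishing_ideal Y (a * p).
Proof. by move=> Ip x Yx; rewrite mevalM Ip ?mulr0. Qed.

Lemma irreducible_prime Y : irreducible Y -> prime_ideal (vanishing_ideal Y).
Proof.
case=> Ya [y0 Yy0] Yirr; apply/prime_idealP; split.
- exact: vanishing_ideal0.
- by move=> /(_ _ Yy0); rewrite meval1; apply/eqP; rewrite oner_eq0.
- exact: vanishing_idealD.
- exact: vanishing_idealM.
move=> p q Ipq.
have YE : Y = (Y `&` [set x | p.@[x ord0] = 0]) `|` (Y `&` [set x | q.@[x ord0] = 0]).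
  apply/seteqP; split=> x; last by case=> -[].
  move=> Yx; have /eqP := Ipq x Yx.
  by rewrite mevalM mulf_eq0 => /orP[] /eqP; [left|right].
have [e|e] := Yirr _ _ (algebraicI p Ya) (algebraicI q Ya) YE; [left|right];
  by move=> x; rewrite e => -[].
Qed.

Lemma separating_polynomial V (x : 'rV[K]_m) :
  algebraic V -> ~ V x -> exists2 p, vanishing_ideal V p & p.@[x ord0] != 0.
Proof.
move=> /algebraic_closure VE Vx; apply: contrapT => h; apply: Vx; rewrite -VE => p Ip.
by apply/eqP/negPn/negP => px; apply: h; exists p.
Qed.

(** If [Y] were a union of two proper algebraic subsets, polynomials separating each
    of them from [Y] would have their product in the ideal of [Y]. *)
Lemma prime_irreducible Y :
  algebraic Y -> prime_ideal (vanishing_ideal Y) -> irreducible Y.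
Proof.
move=> Ya /prime_idealP[_ I1 _ _ IP]; split=> //.
  apply: contrapT => Y0; apply: I1 => x Yx; case: Y0; by exists x.
move=> Y1 Y2 Y1a Y2a YE; apply: contrapT => /not_orP[nY1 nY2].
have sep Y' : algebraic Y' -> Y' `<=` Y -> Y <> Y' ->
    exists2 p, vanishing_ideal Y' p & ~ vanishing_ideal Y p.
  move=> Y'a sY' nY'; apply: contrapT => h; apply: nY'; apply/seteqP; split=> // x Yx.
  apply: contrapT => /(separating_polynomial Y'a)[p Ip px]; apply: h.
  by exists p => // /(_ x Yx)/eqP; rewrite (negPf px).
have [|p Ip nIp] := sep Y1 Y1a _ nY1; first by rewrite YE; left.
have [|q Iq nIq] := sep Y2 Y2a _ nY2; first by rewrite YE; right.
have [||] // := IP p q _; move=> x; rewrite YE mevalM => -[/Ip ->|/Iq ->].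
  by rewrite mul0r.
by rewrite mulr0.
Qed.

(** * Images of rational maps *)

Section RationalImage.
Variables (d : nat) (D : {mpoly K[d]}) (u : 'I_m -> {mpoly K[d]}).

(** Coordinates share the denominator [D]; the image is taken over the locus where
    [D] does not vanish. *)
Definition rat_map (x : 'I_d -> K) : 'rV[K]_m :=
  \row_i (D.@[x]^-1 * (u i).@[x]).

Definition rat_image : set 'rV[K]_m :=
  [set y | exists x, D.@[x] != 0 /\ y = rat_map x].

Lemma pullback_rat_map x p :
  D.@[x] != 0 -> (pullback D u p).@[x] = D.@[x] ^+ msize p * p.@[rat_map x ord0].
Proof.
move=> Dx; have DV : D.@[x]^-1 * mmap (@idfun K) x D = 1 by rewrite mulVf.
rewrite [LHS](mmap_pullback u p DV).
by congr (_ * _); apply: eq_mmap => // i; rewrite /= mxE.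
Qed.

Hypothesis natr_inj : injective (fun n : nat => n%:R : K).
Hypothesis D0 : D != 0.

Lemma vanishing_rat_image p :
  vanishing_ideal rat_image p <-> pullback D u p = 0.
Proof.
split=> [Ip|Ip y [x [Dx ->]]].
  apply: (mulfI D0); rewrite mulr0; apply: (mpoly_vanishes natr_inj) => x.
  rewrite mevalM; have [->|Dx] := eqVneq D.@[x] 0; first by rewrite mul0r.
  by rewrite pullback_rat_map // Ip ?mulr0 //; exists x.
have := pullback_rat_map p Dx; rewrite Ip meval0 => /esym/eqP.
by rewrite mulf_eq0 expf_eq0 (negPf Dx) andbF => /eqP.
Qed.

(** The ideal is the preimage of 0 under the substitution [p |-> p(u / D)] with values
    in a field of rational functions, hence prime. *)
Lemma prime_rat_image : prime_ideal (vanishing_ideal rat_image).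
Proof.
apply/prime_idealP; split.
- exact: vanishing_ideal0.
- move=> I1; case/eqP: D0; apply: (mpoly_vanishes natr_inj) => x.
  apply/eqP/negPn/negP => Dx; have := I1 (rat_map x); rewrite meval1.
  by move=> /(_ (ex_intro _ x (conj Dx erefl)))/eqP; rewrite oner_eq0.
- exact: vanishing_idealD.
- exact: vanishing_idealM.
move=> p q Ipq.
have : D * (pullback D u p * pullback D u q) = 0.
  apply: (mpoly_vanishes natr_inj) => x; rewrite !mevalM.
  have [->|Dx] := eqVneq D.@[x] 0; first by rewrite mul0r.
  have := Ipq (rat_map x) (ex_intro _ x (conj Dx erefl)).
  rewrite mevalM !pullback_rat_map // => /eqP.
  by rewrite mulf_eq0 => /orP[] /eqP ->; rewrite ?(mulr0, mul0r).
move=> /eqP; rewrite !mulf_eq0 (negPf D0) /= => /orP[] /eqP h; [left|right];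
  exact/vanishing_rat_image.
Qed.

End RationalImage.
End Varieties.

(** * Algebraic dependence on the image of a rational map *)

Section Degree.
Variables (K : idomainType) (d : nat).
Implicit Types p q : {mpoly K[d]}.

Definition deg_le t p := (msize p <= t.+1)%N.

Lemma deg_leM s t p q : deg_le s p -> deg_le t q -> deg_le (s + t) (p * q).
Proof.
rewrite /deg_le => sp tq; have [->|p0] := eqVneq p 0; first by rewrite mul0r msize0.
have [->|q0] := eqVneq q 0; first by rewrite mulr0 msize0.
by rewrite msizeM //; lia.
Qed.

Lemma deg_leX s p k : deg_le s p -> deg_le (k * s) (p ^+ k).
Proof.
move=> sp; elim: k => [|k IH]; first by rewrite expr0 /deg_le msize1.
by rewrite exprS mulSn deg_leM.
Qed.

Lemma deg_le_prod k (s : 'I_k -> nat) (p : 'I_k -> {mpoly K[d]}) :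
  (forall i, deg_le (s i) (p i)) -> deg_le (\sum_i s i) (\prod_i p i).
Proof.
move=> sp; apply: (big_ind2 deg_le) => [|s1 p1 s2 p2 h1 h2|i _] //.
  by rewrite /deg_le msize1.
exact: deg_leM.
Qed.

End Degree.

(** Counting behind algebraic dependence: exponent boxes of side [M] in [e] variables
    eventually outnumber the monomials of degree [O(M)] in [d < e] variables. *)
Lemma box_count (e d S : nat) : (d < e)%N ->
  exists M, ((e * M * S).+1 ^ d < M ^ e)%N.
Proof.
move=> de; pose B := ((e * S).+1 ^ d)%N; exists B.+1.
apply: (@leq_ltn_trans (B * B.+1 ^ d)).
  rewrite /B -expnMn; case: (posnP d) => [->//|d0]; rewrite leq_exp2r //.
  by rewrite mulSn; lia.
apply: (@leq_trans (B.+1 * B.+1 ^ d)); first by rewrite ltn_pmul2r ?expn_gt0.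
by rewrite -expnS leq_pexp2l.
Qed.

Lemma kernel_vector (K : fieldType) p q (M : 'M[K]_(p, q)) :
  (q < p)%N -> exists2 v : 'rV_p, v != 0 & v *m M = 0.
Proof.
move=> qp; have : kermx M != 0.
  rewrite -mxrank_eq0 mxrank_ker -lt0n subn_gt0.
  exact: leq_ltn_trans (rank_leq_col M) qp.
by move=> /rowV0Pn[v /sub_kermxP vM v0]; exists v.
Qed.

Section Dependence.
Variables (K : closedFieldType) (m d : nat).
Variables (D : {mpoly K[d]}) (u : 'I_m -> {mpoly K[d]}).

(** A set parametrized by [d] variables has transcendence degree at most [d]. Over the
    common denominator [E ^+ (e * M)], each of the [M ^ e] monomials in the [f i] with
    exponents below [M] pulls back to a polynomial of degree at most [e * M * S] in
    [d] variables. There are fewer such monomials than [M ^ e], so the pullbacks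
    satisfy a linear relation. *)
Lemma rat_image_dependent e (f : 'I_e -> {mpoly K[m]}) :
  (d < e)%N -> exists2 F : {mpoly K[e]}, F != 0 &
    vanishing_ideal (rat_image D u) (mmap (@mpolyC m K) f F).
Proof.
move=> de; pose s := (\sum_i msize (f i))%N.
have fs i : (msize (f i) <= s)%N by rewrite /s (bigD1 i) //= leq_addr.
pose G i := D ^+ (s - msize (f i)) * pullback D u (f i).
pose E := D ^+ s.
have GE i x : D.@[x] != 0 -> (G i).@[x] = E.@[x] * (f i).@[rat_map D u x ord0].
  move=> Dx; rewrite mevalM pullback_rat_map // mulrA; congr (_ * _).
  by rewrite !rmorphXn /= -exprD subnK.
pose S := (\sum_i msize (G i) + msize E)%N.
have [M MS] := box_count S de.
pose mon (c : {ffun 'I_e -> 'I_M}) : {mpoly K[d]} :=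
  \prod_i (G i ^+ c i * E ^+ (M - c i)).
have mon_deg c : deg_le (e * M * S) (mon c).
  have -> : (e * M * S = \sum_(i < e) (M * S))%N by rewrite sum_nat_const card_ord mulnA.
  apply: deg_le_prod => i.
  have -> : (M * S = c i * S + (M - c i) * S)%N by rewrite -mulnDl subnKC // ltnW.
  apply: deg_leM; apply: deg_leX; apply: leqW; rewrite /S.
    by rewrite (bigD1 i) //= -addnA leq_addr.
  exact: leq_addl.
pose T := {ffun 'I_d -> 'I_(e * M * S).+1}.
pose mnm_of (b : T) : 'X_{1..d} := [multinom (b i : nat) | i < d].
pose Q : 'M[K]_(#|{ffun 'I_e -> 'I_M}|, #|T|) :=
  \matrix_(r, c) (mon (enum_val r))@_(mnm_of (enum_val c)).
have [|v v0 vQ] := @kernel_vector K _ _ Q; first by rewrite !card_ffun !card_ord.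
pose lam (c : {ffun 'I_e -> 'I_M}) := v ord0 (enum_rank c).
pose emn (c : {ffun 'I_e -> 'I_M}) : 'X_{1..e} := [multinom (c i : nat) | i < e].
have emn_inj : injective emn.
  move=> c1 c2 /mnmP h; apply/ffunP => i; apply: val_inj.
  by have := h i; rewrite !mnmE.
have relation : \sum_c lam c *: mon c = 0.
  apply/mpolyP => a; rewrite mcoeff0 raddf_sum /=.
  have [aS|aS] := leqP (mdeg a) (e * M * S); last first.
    rewrite big1 // => c _; rewrite mcoeffZ.
    have -> : (mon c)@_a = 0; last by rewrite mulr0.
    by apply: memN_msupp_eq0; apply: msize_mdeg_ge; apply: leq_trans (mon_deg c) aS.
  have ai i : (a i < (e * M * S).+1)%N.
    by rewrite ltnS (leq_trans _ aS) // mdegE (bigD1 i) //= leq_addr.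
  pose b : T := [ffun i => Ordinal (ai i)].
  have -> : a = mnm_of b by apply/mnmP => i; rewrite mnmE ffunE.
  have /matrixP/(_ ord0 (enum_rank b)) := vQ; rewrite !mxE => vQE.
  apply: etrans vQE.
  rewrite (reindex_onto (@enum_val {ffun 'I_e -> 'I_M} predT) enum_rank) /=; last first.
    by move=> c _; rewrite enum_rankK.
  apply: eq_big => [r|r _]; first by rewrite enum_valK eqxx.
  by rewrite mcoeffZ mxE /lam enum_valK enum_rankK.
exists (\sum_c lam c *: 'X_[emn c]).
  apply: contra v0 => /eqP F0; apply/eqP/rowP => r; rewrite mxE.
  have /(congr1 (mcoeff (emn (enum_val r)))) := F0.
  rewrite mcoeff0 raddf_sum /= (bigD1 (enum_val r)) //= big1 ?addr0 => [|c cr].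
    by rewrite mcoeffZ mcoeffX eqxx mulr1 /lam enum_valK.
  by rewrite mcoeffZ mcoeffX (inj_eq emn_inj) (negPf cr) mulr0.
move=> y [x [Dx ->]].
have Ex : E.@[x] != 0 by rewrite /E rmorphXn expf_eq0 (negPf Dx) andbF.
have ExM : E.@[x] ^+ (e * M) != 0 by rewrite expf_eq0 (negPf Ex) andbF.
apply: (mulfI ExM); rewrite mulr0.
have := congr1 (meval x) relation; rewrite meval0; apply: etrans.
rewrite (raddf_sum (mmap (@mpolyC m K) f)) !(raddf_sum (meval _)) mulr_sumr.
apply: eq_bigr => c _ /=.
rewrite mmapZ mmapX mul_mpolyC !mevalZ mulrCA; congr (_ * _).
rewrite /mmap1 !rmorph_prod /=.
have -> : E.@[x] ^+ (e * M) = \prod_(i < e) E.@[x] ^+ M.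
  by rewrite prodr_const card_ord -exprM mulnC.
rewrite -big_split; apply: eq_bigr => i _ /=.
rewrite mnmE mevalM [(G i ^+ _).@[_]]rmorphXn [(E ^+ _).@[_]]rmorphXn /= GE //.
rewrite exprMn [RHS]mulrAC -exprD subnKC; last exact: ltnW.
by congr (_ * _); exact: rmorphXn.
Qed.

End Dependence.

(** * Chains of irreducible sets *)

Section Chains.
Variables (K : closedFieldType) (m : nat).
Hypothesis natr_inj : injective (fun n : nat => n%:R : K).
Implicit Types (V Y : set 'rV[K]_m).

(** Elements [f i] chosen in the successive differences of a descending chain of primes
    are algebraically independent modulo the smallest prime. Write a relation as a
    polynomial [q * 'X + c] in the last element, which lies in [P e] but not in
    [P e.+1]. Modulo the larger [P e] only [c] survives, and it vanishes by induction;
    then primality of [P e.+1] lets the last element be cancelled. *)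
Lemma chain_independent e (P : nat -> set {mpoly K[m]}) (f : 'I_e -> {mpoly K[m]}) :
  (forall i, (i <= e)%N -> prime_ideal (P i)) ->
  (forall i, (i < e)%N -> P i.+1 `<=` P i) ->
  (forall i : 'I_e, P i (f i) /\ ~ P i.+1 (f i)) ->
  forall F : {mpoly K[e]}, P e (mmap (@mpolyC m K) f F) -> F = 0.
Proof.
elim: e f => [|e IH] f Pprime Pdec fP F PF.
  rewrite (mpoly0_const F) mmapC in PF *.
  have [->|c0] := eqVneq F@_0%MM 0; first by rewrite mpolyC0.
  have /prime_idealP[_ I1 _ IM _] := Pprime 0%N isT; case: I1.
  have := IM (F@_0%MM)^-1%:MP _ PF.
  by rewrite -mpolyCM mulVf // mpolyC1.
apply: muni_eq0; move: PF; rewrite mmap_muni.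
set ev := mmap _ _; set fe := f ord_max.
have /prime_idealP[_ _ _ _ I'P] := Pprime e.+1 (leqnn _).
have /prime_idealP[_ _ ID IM _] := Pprime e (leqnSn _).
have [fePe nfePe] := fP ord_max.
have {}IH G : P e (ev G) -> G = 0.
  apply: IH => [i ie|i ie|i].
  - by apply: Pprime; apply: leqW.
  - by apply: Pdec; apply: leqW.
  - exact: fP (widen_ord (leqnSn e) i).
elim/poly_ind: (muni F) => // q c IHq.
rewrite rmorphD rmorphM /= map_polyX map_polyC hornerMXaddC /= => Pq.
have c0 : c = 0.
  apply: IH; rewrite -[ev c](addKr ((map_poly ev q).[fe] * fe)) addrC.
  apply: ID; first exact: Pdec Pq.
  by rewrite -mulNr; apply: IM.
move: Pq; rewrite c0 rmorph0 addr0 => /I'P[/IHq ->|//].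
by rewrite mul0r addr0.
Qed.

(** Krull dimension is bounded by the number of chart variables: separating polynomials
    along a chain of length [e] are independent modulo the ideal of the largest member,
    whereas on a chart meeting that member any [e > d] polynomials are dependent.
    Multiplying the relation by the equation [delta] of the complement of the chart
    makes it hold on the whole of [V]. *)
Lemma chain_length_le V d :
  (forall z, V z -> exists D (u : 'I_m -> {mpoly K[d]}) (delta : {mpoly K[m]}),
     delta.@[z ord0] != 0 /\
     forall y, V y -> delta.@[y ord0] != 0 -> rat_image D u y) ->
  forall e W, irreducible_chain V e W -> (e <= d)%N.
Proof.
move=> charts e W [Wirr Wstrict]; rewrite leqNgt; apply/negP => de.
have WP i (ie : (i <= e)%N) := irreducible_prime (Wirr i ie).1.
have sepf (i : 'I_e) : exists f, vanishing_ideal (W i) f /\ ~ vanishing_ideal (W i.+1) f.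
  have [_ nWW] := Wstrict i (ltn_ord i).
  apply: contrapT => nf; apply: nWW => x Wx; apply: contrapT => nWx.
  have [[Wa _ _] _] := Wirr i (ltnW (ltn_ord i)).
  have [f If fx] := separating_polynomial Wa nWx.
  by apply: nf; exists f; split=> // /(_ x Wx)/eqP; rewrite (negPf fx).
have [f fP] := choice sepf.
have [[_ [z Wz] _] WV] := Wirr e (leqnn e).
have [D [u [delta [dz chart]]]] := charts z (WV z Wz).
have [F F0 IF] := rat_image_dependent D u f de.
case/eqP: F0; apply: (@chain_independent e (fun i => vanishing_ideal (W i)) f) => //.
  by move=> i ie; apply: vanishing_idealS; case: (Wstrict i ie).
have /prime_idealP[_ _ _ _ IP] := WP e (leqnn e).
have [||//] := IP delta (mmap (@mpolyC m K) f F); last first.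
  by move=> /(_ z Wz)/eqP; rewrite (negPf dz).
move=> y Wy; rewrite mevalM; have [->|dy] := eqVneq delta.@[y ord0] 0.
  by rewrite mul0r.
by rewrite (IF y) ?mulr0 //; apply: chart dy; apply: WV.
Qed.

(** The closures of the images of the coordinate flag of the chart domain. They are
    irreducible as images of rational maps, and strictly increasing because the chart
    coordinates are detected by the polynomials [g i] on the target. *)
Lemma chain_exists V d (D : {mpoly K[d]}) (u : 'I_m -> {mpoly K[d]})
    (g : 'I_d -> {mpoly K[m]}) :
  algebraic V -> rat_image D u `<=` V -> D.@[fun=> 0] != 0 ->
  (forall x i, D.@[x] != 0 -> (g i).@[rat_map D u x ord0] = 0 <-> x i = 0) ->
  exists W, irreducible_chain V d W.
Proof.
move=> Va imV D0 gP.
(* The flag: all coordinates of index at least [j] are set to 0. *)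
pose X_ j (a : 'I_d) : {mpoly K[d]} := if (a < j)%N then 'X_a else 0.
pose trunc j (x : 'I_d -> K) (a : 'I_d) := if (a < j)%N then x a else 0.
pose res j := mmap (@mpolyC d K) (X_ j).
have resE j x p : (res j p).@[x] = p.@[trunc j x].
  rewrite /meval /res (mmap_comp (@idfun K)); apply: eq_mmap => // a.
  rewrite -/(meval x (X_ j a)) /X_ /trunc.
  by case: ifP => _; rewrite ?mevalXU ?meval0.
pose U j := rat_image (res j D) (res j \o u).
have UP j y : U j y <-> exists x, D.@[trunc j x] != 0 /\ y = rat_map D u (trunc j x).
  have ratE x : rat_map (res j D) (res j \o u) x = rat_map D u (trunc j x).
    by apply/rowP => i; rewrite !mxE !resE.
  by split=> -[x [Dx ->]]; exists x; move: Dx; rewrite resE ratE.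
have D00 j : D.@[trunc j (fun=> 0)] != 0.
  by rewrite (@meval_eq _ _ _ (fun=> 0)) // => a; rewrite /trunc if_same.
have res0 j : res j D != 0.
  by apply: contra_neq (D00 j); rewrite -resE => ->; rewrite meval0.
exists (fun j => zariski_closure (U j)); split=> [j jd|j jd].
  split; last first.
    apply: closure_min Va _ => y /UP[x [Dx ->]]; apply: imV.
    by exists (trunc j x).
  apply: prime_irreducible; first exact: closure_algebraic.
  by rewrite vanishing_closure; apply: prime_rat_image.
split.
  apply: closure_min (closure_algebraic _) _ => y /UP[x [Dx ->]].
  apply: sub_closure; apply/UP; exists (trunc j x).
  have tE : trunc j.+1 (trunc j x) =1 trunc j x.
    by move=> a; rewrite /trunc; case: ltnP => // h; case: ltnP => //; lia.
  rewrite (meval_eq _ tE); split=> //; apply/rowP => i; rewrite !mxE.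
  by rewrite !(meval_eq _ tE).
(* The next image leaves the hyperplane [g a = 0], which contains the present one. *)
move=> /(_ _ (sub_closure _)) sub; pose a := Ordinal jd.
have : res j.+1 D * 'X_a != 0.
  rewrite mulf_neq0 //; apply/eqP => /(congr1 (meval (fun=> 1))).
  by rewrite mevalXU meval0; apply/eqP; rewrite oner_eq0.
case/eqP; apply: (mpoly_vanishes natr_inj) => x; rewrite mevalM mevalXU resE.
have [->|Dx] := eqVneq D.@[trunc j.+1 x] 0; first by rewrite mul0r.
suff -> : x a = 0 by rewrite mulr0.
have <- : trunc j.+1 x a = x a by rewrite /trunc /= ltnSn.
apply/(gP _ a Dx).
apply: (sub (rat_map D u (trunc j.+1 x))) => [|y /UP[x' [Dx' ->]]].
  by apply/UP; exists x.
by apply/gP => //; rewrite /trunc /= ltnn.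
Qed.

End Chains.

(** * Ideals generated by a set, and localization *)

Section IdealSpan.
Variable A : comNzRingType.
Implicit Type S I : set A.

Lemma ideal_span_min S I :
  I 0 -> (forall p q, I p -> I q -> I (p + q)) -> (forall a p, I p -> I (a * p)) ->
  S `<=` I -> ideal_span S `<=` I.
Proof.
move=> I0 ID IM SI p [r [a [g [gS ->]]]].
by apply: (big_ind I) => // i _; apply/IM/SI/gS.
Qed.

Lemma ideal_span_gen S : S `<=` ideal_span S.
Proof.
by move=> p Sp; exists 1%N, (fun=> 1), (fun=> p); rewrite big_ord1 mul1r.
Qed.

Lemma ideal_span0 S : ideal_span S 0.
Proof. by exists 0%N, (fun=> 0), (fun=> 0); rewrite big_ord0; split=> // -[]. Qed.

Lemma ideal_spanM S a p : ideal_span S p -> ideal_span S (a * p).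
Proof.
case=> r [b [g [gS ->]]]; exists r, (fun i => a * b i), g; split=> //.
by rewrite mulr_sumr; apply: eq_bigr => i _; rewrite mulrA.
Qed.

Lemma ideal_spanD S p q : ideal_span S p -> ideal_span S q -> ideal_span S (p + q).
Proof.
case=> r [a [g [gS ->]]] [s [b [h [hS ->]]]].
exists (r + s)%N, (fun i => match split i with inl j => a j | inr j => b j end),
  (fun i => match split i with inl j => g j | inr j => h j end); split.
  by move=> i; case: splitP => j _.
rewrite big_split_ord; congr (_ + _); apply: eq_bigr => i _ /=.
  by rewrite -[lshift s i]/(unsplit (inl i)) unsplitK.
by rewrite -[rshift r i]/(unsplit (inr i)) unsplitK.
Qed.

Lemma ideal_span_sum S (J : Type) (r : seq J) (P : pred J) (F : J -> A) :
  (forall j, P j -> ideal_span S (F j)) -> ideal_span S (\sum_(j <- r | P j) F j).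
Proof. by apply: big_ind; [exact: ideal_span0 | exact: ideal_spanD]. Qed.

(** The [a] with some power in the colon ideal [(S : p)] form the radical of that
    ideal, which is closed under addition by the binomial formula. *)
Lemma colon_radicalD S p a b :
  (exists M, ideal_span S (a ^+ M * p)) -> (exists M, ideal_span S (b ^+ M * p)) ->
  exists M, ideal_span S ((a + b) ^+ M * p).
Proof.
move=> [m am] [n bn]; exists (m + n)%N; rewrite exprDn mulr_suml.
apply: ideal_span_sum => i _; rewrite mulrnAl -mulr_natl.
apply: ideal_spanM; have [ni|ni] := leqP n i.
  by rewrite -(subnK ni) exprD -!mulrA; do 2!apply: ideal_spanM.
rewrite -addnBA 1?ltnW // addnC exprD -[_ * _ * p]mulrA mulrACA; exact: ideal_spanM.
Qed.

Lemma colon_radical_sum S p (J : Type) (r : seq J) (F : J -> A) :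
  (forall j, exists M, ideal_span S (F j ^+ M * p)) ->
  exists M, ideal_span S ((\sum_(j <- r) F j) ^+ M * p).
Proof.
move=> h; elim/big_ind: _ => //; last exact: colon_radicalD.
by exists 1%N; rewrite expr1 mul0r; apply: ideal_span0.
Qed.

End IdealSpan.

Lemma span_quotient (A : comNzRingType) (S : set A) : ~ ideal_span S 1 ->
  exists (C : comNzRingType) (g : {rmorphism A -> C}),
    forall p, g p = 0 <-> ideal_span S p.
Proof.
move=> S1; pose I : pred A := fun p => `[< ideal_span S p >].
have I_ideal : idealr_closed I.
  split; first exact/asboolP/ideal_span0.
    by apply/negP => /asboolP.
  move=> a p q /asboolP Ip /asboolP Iq.
  by apply/asboolP/ideal_spanD => //; apply: ideal_spanM.
pose IaM := GRing.isZmodClosed.Build _ I (idealr_closedB I_ideal).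
pose IpM := isProperIdeal.Build _ I (idealr_closed_nontrivial I_ideal).
pose Iid : idealr A := HB.pack I IaM IpM.
pose C : comNzRingType := {ideal_quot Iid}; pose g : {rmorphism A -> C} := (\pi_C)%qT.
exists C, g => p.
have E : (p \in Iid) = (g p == g 0).
  by rewrite -[p in LHS]subr0 Quotient.idealrBE.
rewrite rmorph0 in E.
split=> [/eqP|Ip]; first by rewrite -E => /asboolP.
by apply/eqP; rewrite -E; apply/asboolP.
Qed.

(** If [p] vanishes in every algebra where [S] vanishes and [delta] is invertible, then
    it vanishes in the universal one, [A[X] / (S, delta X - 1)]. Substituting
    [X = 1 / delta] in the resulting identity and clearing denominators gives the
    conclusion in [A]. *)
Lemma localization_principle (A : idomainType) (S : set A) (delta p : A) :
  (forall (C : comNzRingType) (g : {rmorphism A -> C}) t,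
     t * g delta = 1 -> (forall s, S s -> g s = 0) -> g p = 0) ->
  exists M, ideal_span S (delta ^+ M * p).
Proof.
move=> univ; have [d0|d0] := eqVneq delta 0.
  by exists 1%N; rewrite d0 expr1 mul0r; apply: ideal_span0.
pose S' : set {poly A} := [set q | q = delta *: 'X - 1 \/ exists2 s, S s & q = s%:P].
have : ideal_span S' p%:P.
  (* The quotient is a nontrivial ring only when the ideal is proper. *)
  have [S'1|S'1] := pselect (ideal_span S' 1).
    by rewrite -[_%:P]mulr1; apply: ideal_spanM.
  have [C [g gP]] := span_quotient S'1.
  apply/gP; apply: (univ C (g \o polyC) (g 'X)) => [|s Ss] /=.
    apply/eqP; rewrite -subr_eq0 -rmorphM -[X in _ - X](rmorph1 g) -rmorphB.
    rewrite mulrC mul_polyC.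
    by apply/eqP/gP/ideal_span_gen; left.
  by apply/gP/ideal_span_gen; right; exists s.
pose F := {fraction A}; pose f : {rmorphism A -> F} := @tofrac A.
have fd : f delta != 0 by rewrite /f tofrac_eq0.
pose ev (q : {poly A}) : F := (map_poly f q).[(f delta)^-1].
have evD q r : ev (q + r) = ev q + ev r by rewrite /ev rmorphD hornerD.
have evM q r : ev (q * r) = ev q * ev r by rewrite /ev rmorphM hornerM.
have evC a : ev a%:P = f a by rewrite /ev map_polyC hornerC.
have ev0 : ev 0 = 0 by rewrite /ev rmorph0 horner0.
have clear q : exists M b, f delta ^+ M * ev q = f b.
  elim/poly_ind: q => [|q c [M [b IH]]].
    by exists 0%N, 0; rewrite ev0 rmorph0 mulr0.
  exists M.+1, (b + delta ^+ M.+1 * c).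
  rewrite evD evM evC [ev 'X]/ev map_polyX hornerX mulrDr exprSr mulrACA divff // mulr1.
  by rewrite IH rmorphD rmorphM !rmorphXn exprSr.
pose I : set {poly A} := [set q | exists M b, ideal_span S b /\ f delta ^+ M * ev q = f b].
have : ideal_span S' `<=` I.
  apply: ideal_span_min.
  - exists 0%N, 0; split; first exact: ideal_span0.
    by rewrite ev0 rmorph0 mulr0.
  - move=> q r [M [b [Ib qb]]] [N [c [Ic rc]]].
    exists (M + N)%N, (delta ^+ N * b + delta ^+ M * c); split.
      by apply: ideal_spanD; apply: ideal_spanM.
    rewrite rmorphD !rmorphM !rmorphXn -qb -rc evD exprD.
    by ring.
  - move=> a q [M [b [Ib qb]]]; have [N [c ac]] := clear a.
    exists (N + M)%N, (c * b); split; first exact: ideal_spanM.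
    by rewrite rmorphM -ac -qb evM exprD mulrACA.
  - move=> q [->|[s Ss ->]].
      exists 0%N, 0; split; first exact: ideal_span0.
      rewrite /ev -mul_polyC rmorphB rmorphM /= map_polyC map_polyX rmorph1.
      by rewrite hornerD hornerN hornerM !hornerC hornerX divff // subrr mulr0 rmorph0.
    exists 0%N, s; split; first exact: ideal_span_gen.
    by rewrite evC mul1r.
move=> sub /sub[M [b [Ib]]]; rewrite evC -rmorphXn -rmorphM => /eqP.
by rewrite tofrac_eq => /eqP pb; exists M; rewrite pb.
Qed.

(** * The Cayley transform over a commutative ring *)

Ltac entrywise := apply/matrixP => i j; rewrite !mxE; ring.

Lemma mulmxnAr (R : pzSemiRingType) m n p (M : 'M[R]_(m, n)) (N : 'M[R]_(n, p)) i :
  M *m (N *+ i) = (M *m N) *+ i.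
Proof. by elim: i => [|i IH]; rewrite ?mulmx0 // !mulrS mulmxDr IH. Qed.

Lemma mulmxnAl (R : pzSemiRingType) m n p (M : 'M[R]_(m, n)) (N : 'M[R]_(n, p)) i :
  (M *+ i) *m N = (M *m N) *+ i.
Proof. by elim: i => [|i IH]; rewrite ?mul0mx // !mulrS mulmxDl IH. Qed.

Section Cayley.
Variables (C : comNzRingType) (k l : nat).
Implicit Types (H P W X : 'M[C]_k) (B Y : 'M[C]_(l, k)) (Z : 'M[C]_(k + l, k)).

(** The Cayley transform of the skew matrix with blocks [H], [- B^T], [B], [0], cut down
    to its first [k] columns. Those columns are [[2P - 1; - 2BP]] where [P] is the
    inverse of the Schur complement [1 + H + B^T B] of the identity block. *)
Definition cayley_den H B : 'M[C]_k := 1%:M + H + B^T *m B.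

Definition cayley B P : 'M[C]_(k + l, k) := col_mx (P *+ 2 - 1%:M) (- (B *m P) *+ 2).

Lemma gram_col_mx X Y : (col_mx X Y)^T *m col_mx X Y = X^T *m X + Y^T *m Y.
Proof. by rewrite tr_col_mx mul_row_col. Qed.

(** Since [M + M^T = 2 (1 + B^T B)] for the skew [H], conjugating by [P] gives
    [P + P^T = 2 P^T (1 + B^T B) P], which is the Gram identity once expanded. *)
Lemma cayley_stiefel H B P :
  H^T = - H -> cayley_den H B *m P = 1%:M -> (cayley B P)^T *m cayley B P = 1%:M.
Proof.
move=> Hskew MP; set M := cayley_den H B in MP; pose G := 1%:M + B^T *m B.
have MMT : M + M^T = G *+ 2.
  rewrite /M /cayley_den !linearD /= trmx_mul trmxK trmx1 Hskew mulr2n /G.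
  by move: 1%:M (B^T *m B) => I S; entrywise.
have PTMT : P^T *m M^T = 1%:M by rewrite -trmx_mul MP trmx1.
have key : P + P^T = (P^T *m G *m P) *+ 2.
  rewrite -mulmxnAl -mulmxnAr.
  by rewrite  -MMT mulmxDr mulmxDl PTMT mul1mx -mulmxA MP mulmx1 addrC.
rewrite gram_col_mx.
have -> : (P *+ 2 - 1%:M)^T *m (P *+ 2 - 1%:M) = (P^T *m P) *+ 4 - (P + P^T) *+ 2 + 1%:M.
  rewrite [(_ - _)^T]linearB /= [(_ *+ _)^T]linearMn /= trmx1.
  rewrite mulmxBl !mulmxBr !mulmx1 !mul1mx.
  by rewrite mulmxnAl mulmxnAr; move: (P^T *m P) 1%:M P^T => ? ? ?; entrywise.
have -> : (- (B *m P) *+ 2)^T *m (- (B *m P) *+ 2) = (P^T *m (B^T *m B) *m P) *+ 4.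
  rewrite [(_ *+ _)^T]linearMn /= [(- _)^T]linearN /= mulmxnAl mulmxnAr.
  rewrite mulNmx mulmxN trmx_mul !mulmxA.
  by move: (_ *m P) => ?; entrywise.
rewrite key /G mulmxDr mulmxDl mulmx1.
by move: (P^T *m P) (P^T *m _ *m P) 1%:M => ? ? ?; entrywise.
Qed.

Lemma cayley_top B P : 1%:M + usubmx (cayley B P) = P *+ 2.
Proof. by rewrite col_mxKu addrC subrK. Qed.

(** The inverse transform. From [1 + X = 2P] and [Y = - 2BP] one reads off
    [B = - Y (1 + X)^-1] and [H = 2 (1 + X)^-1 - 1 - B^T B]; the equation
    [X^T X + Y^T Y = 1] says exactly that this [H] is skew. *)
Lemma inv_cayley (half : C) X Y W (B := - (Y *m W))
    (H := W *+ 2 - 1%:M - B^T *m B) (P := half *: (1%:M + X)) :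
  half * 2 = 1 -> X^T *m X + Y^T *m Y = 1%:M -> W *m (1%:M + X) = 1%:M ->
  [/\ H^T = - H, cayley_den H B *m P = 1%:M & cayley B P = col_mx X Y].
Proof.
move=> half2 XY WQ; set Q := 1%:M + X in P WQ *.
have P2 : P *+ 2 = Q by rewrite -scaler_nat scalerA mulrC half2 scale1r.
have QTWT : Q^T *m W^T = 1%:M by rewrite -trmx_mul WQ trmx1.
have WTQT : W^T *m Q^T = 1%:M by apply: mulmx1C.
have QW : Q *m W = 1%:M by apply: mulmx1C.
have BB : B^T *m B = W^T *m (Y^T *m Y) *m W.
  by rewrite [(- _)^T]linearN /= mulNmx mulmxN opprK trmx_mul !mulmxA.
have YY : Y^T *m Y = Q + Q^T - Q^T *m Q.
  rewrite -[Y^T *m Y](addKr (X^T *m X)) XY /Q linearD /= trmx1.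
  rewrite mulmxDl !mulmxDr !mulmx1 !mul1mx.
  by move: (X^T *m X) X^T 1%:M => ? ? ?; entrywise.
have key : W + W^T = 1%:M + B^T *m B.
  rewrite BB YY mulmxBr mulmxDr mulmxBl mulmxDl WTQT mul1mx -[W^T *m Q *m W]mulmxA QW.
  rewrite mulmxA WTQT mul1mx QW mulmx1.
  by move: 1%:M W^T => ? ?; entrywise.
split.
- apply/eqP; rewrite -addr_eq0; apply/eqP.
  rewrite /H !linearB /= linearMn /= trmx1 trmx_mul trmxK.
  rewrite -[W^T](addKr W) key.
  by move: 1%:M (B^T *m B) => ? ?; entrywise.
- have -> : cayley_den H B = W *+ 2.
    by rewrite /cayley_den /H; move: 1%:M (B^T *m B) => ? ?; entrywise.
  by rewrite mulmxnAl -mulmxnAr P2 WQ.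
- rewrite /cayley /B mulNmx opprK -mulmxnAr P2 -mulmxA WQ mulmx1; congr col_mx.
  by rewrite /Q addrC addKr.
Qed.

End Cayley.

(** * Sign flips of rows *)

Section Flips.
Variables (C : comNzRingType) (k l : nat).
Implicit Types (eps : {ffun 'I_k -> bool}) (Z : 'M[C]_(k + l, k)).

Definition sign_mx eps : 'M[C]_k := diag_mx (\row_i (-1) ^+ eps i).

Definition flip eps Z : 'M[C]_(k + l, k) :=
  col_mx (sign_mx eps *m usubmx Z) (dsubmx Z).

Lemma sign_mxK eps : sign_mx eps *m sign_mx eps = 1%:M.
Proof.
rewrite mulmx_diag -diag_const_mx; congr diag_mx.
by apply/rowP => i; rewrite !mxE -signr_addb addbb.
Qed.

Lemma flipK eps : involutive (flip eps).
Proof.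
by move=> Z; rewrite /flip col_mxKu col_mxKd mulmxA sign_mxK mul1mx vsubmxK.
Qed.

Lemma flip_gram eps Z : (flip eps Z)^T *m flip eps Z = Z^T *m Z.
Proof.
rewrite -[in RHS](vsubmxK Z) !gram_col_mx trmx_mul tr_diag_mx.
by rewrite -mulmxA [_ *m (_ *m usubmx Z)]mulmxA sign_mxK mul1mx.
Qed.

(** The determinants [det (1 + D X)], with [D] a diagonal sign matrix, generate the unit
    ideal when 2 is invertible. In the Leibniz expansion, summing over the signs turns
    the factor [(i == s i) + eps_i * X i (s i)] into [2 * (i == s i)], so only the
    identity permutation contributes. *)
Lemma sum_det_flip (X : 'M[C]_k) :
  \sum_eps \det (1%:M + sign_mx eps *m X) = 2 ^+ k.
Proof.
rewrite exchange_big /=.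
rewrite (eq_bigr (fun s : 'S_k => (-1) ^+ s * \prod_i ((i == s i)%:R *+ 2))); last first.
  move=> s _; rewrite -mulr_sumr; congr (_ * _).
  pose F (i : 'I_k) (b : bool) : C := (i == s i)%:R + (-1) ^+ b * X i (s i).
  rewrite (eq_bigr (fun eps : {ffun 'I_k -> bool} => \prod_i F i (eps i))); last first.
    by move=> eps _; apply: eq_bigr => i _; rewrite mul_diag_mx !mxE.
  rewrite -bigA_distr_bigA; apply: eq_bigr => i _.
  by rewrite big_bool /F /=; ring.
rewrite (bigD1 (1%g : {perm 'I_k})) //= odd_perm1 expr0 mul1r [X in _ + X]big1 ?addr0.
  rewrite (eq_bigr (fun=> 2)) ?prodr_const ?card_ord // => i _.
  by rewrite perm1 eqxx.
move=> s s1; have [i si] : exists i, s i != i.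
  apply/existsP; apply: contraR s1; rewrite negb_exists => /forallP h.
  by apply/eqP/permP => i; rewrite perm1; apply/eqP; rewrite -[_ == _]negbK.
by rewrite (bigD1 i) //= eq_sym (negPf si) mul0rn mul0r mulr0.
Qed.

End Flips.

Lemma map_sign_mx (C C' : comNzRingType) (f : {rmorphism C -> C'}) k
    (eps : {ffun 'I_k -> bool}) :
  map_mx f (sign_mx C eps) = sign_mx C' eps.
Proof.
rewrite map_diag_mx; congr diag_mx; apply/rowP => i; rewrite !mxE.
by rewrite rmorphXn rmorphN1.
Qed.

Lemma map_flip (C C' : comNzRingType) (f : {rmorphism C -> C'}) k l
    (eps : {ffun 'I_k -> bool}) (Z : 'M[C]_(k + l, k)) :
  map_mx f (flip eps Z) = flip eps (map_mx f Z).
Proof. by rewrite map_col_mx map_mxM map_sign_mx map_usubmx map_dsubmx. Qed.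

Lemma flipZ (C : comNzRingType) k l (eps : {ffun 'I_k -> bool}) (Z : 'M[C]_(k + l, k)) w :
  flip eps (w *: Z) = w *: flip eps Z.
Proof.
by rewrite /flip [usubmx _]linearZ [dsubmx _]linearZ /= -scalemxAr scale_col_mx.
Qed.

(** * The Cayley charts *)

(** The strictly upper triangular positions of the top block, together with all
    positions of the bottom block: coordinates for the pairs [(H, B)] with [H] skew. *)
Definition free_entries k l : {set 'I_(k + l) * 'I_k} :=
  finset (fun p : 'I_(k + l) * 'I_k => (p.1 < p.2)%N || (k <= p.1)%N).

Lemma free_top k l (i j : 'I_k) : ((lshift l i, j) \in free_entries k l) = (i < j)%N.
Proof. by rewrite inE /= [(k <= i)%N]leqNgt ltn_ord orbF. Qed.

Lemma free_bottom k l (i : 'I_l) (j : 'I_k) : (rshift k i, j) \in free_entries k l.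
Proof. by rewrite inE /= leq_addr orbT. Qed.

Section ChartPoints.
Variables (k l : nat).
Let d := #|free_entries k l|.

Section OverRing.
Variable C : comNzRingType.
Implicit Type x : 'I_d -> C.

Definition par_mx x : 'M[C]_(k + l, k) :=
  \matrix_(i, j) \sum_(a : 'I_d | enum_val a == (i, j)) x a.

Definition par_skew x : 'M[C]_k := usubmx (par_mx x) - (usubmx (par_mx x))^T.

Definition par_low x : 'M[C]_(l, k) := dsubmx (par_mx x).

Lemma par_mx_enum x a : par_mx x (enum_val a).1 (enum_val a).2 = x a.
Proof.
rewrite mxE (big_pred1 a) // => b.
by rewrite -surjective_pairing (inj_eq enum_val_inj).
Qed.

Lemma par_mx_out x i j : (i, j) \notin free_entries k l -> par_mx x i j = 0.
Proof.
move=> ij; rewrite mxE big_pred0 // => a; apply: contraNF ij => /eqP <-.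
exact: enum_valP.
Qed.

Lemma par_skewT x : (par_skew x)^T = - par_skew x.
Proof. by rewrite linearB /= trmxK opprB. Qed.

Lemma par_colE x a :
  col_mx (par_skew x) (par_low x) (enum_val a).1 (enum_val a).2 = x a.
Proof.
have := enum_valP a; rewrite -[RHS]par_mx_enum.
case: (enum_val a) => i j /=; case: (split_ordP i) => i' ->.
  rewrite free_top col_mxEu => ij.
  rewrite [LHS]mxE [X in X + _]mxE [X in _ + X]mxE [X in _ - X]mxE [X in _ - X]mxE.
  rewrite [X in _ - X]par_mx_out ?subr0 //.
  by rewrite free_top -leqNgt ltnW.
by move=> _; rewrite col_mxEd mxE.
Qed.

(** A skew matrix is determined by its strictly upper part: its diagonal satisfies
    [2 H i i = 0], which [half] turns into [H i i = 0]. *)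
Lemma par_surj (half : C) (H : 'M[C]_k) (B : 'M[C]_(l, k)) :
  half * 2 = 1 -> H^T = - H -> exists x, par_skew x = H /\ par_low x = B.
Proof.
move=> half2 Hskew.
exists (fun a => col_mx H B (enum_val a).1 (enum_val a).2).
set x := fun a => _.
have inE' i j : (i, j) \in free_entries k l -> par_mx x i j = col_mx H B i j.
  move=> ij; have := par_mx_enum x (enum_rank_in ij (i, j)).
  by rewrite /x enum_rankK_in.
have Hd i j : H j i = - H i j by have /matrixP/(_ i j) := Hskew; rewrite !mxE.
have H0 i : H i i = 0.
  by rewrite -[H i i]mul1r -half2 -mulrA mulr_natl mulr2n {1}Hd addNr mulr0.
split; last first.
  by apply/matrixP => i j; rewrite mxE inE' ?col_mxEd ?free_bottom.
apply/matrixP => i j.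
rewrite [LHS]mxE [X in X + _]mxE [X in _ + X]mxE [X in _ - X]mxE [X in _ - X]mxE.
have low (i' j' : 'I_k) : (j' <= i')%N -> par_mx x (lshift l i') j' = 0.
  by move=> ji; rewrite par_mx_out // free_top -leqNgt.
have up (i' j' : 'I_k) : (i' < j')%N -> par_mx x (lshift l i') j' = H i' j'.
  by move=> ij; rewrite inE' ?col_mxEu ?free_top.
case: (ltngtP i j) => ij.
- by rewrite up // low ?subr0 // ltnW.
- by rewrite low ?(ltnW ij) // up // sub0r Hd opprK.
- by have -> : i = j by [apply: val_inj]; rewrite low // subrr H0.
Qed.

End OverRing.

Lemma map_par_mx (C C' : comNzRingType) (f : {rmorphism C -> C'}) x x' :
  f \o x =1 x' -> map_mx f (par_mx x) = par_mx x'.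
Proof.
move=> fx; apply/matrixP => i j; rewrite !mxE rmorph_sum.
by apply: eq_bigr => a _; apply: fx.
Qed.

End ChartPoints.

Section Charts.
Variables (K : closedFieldType) (k l : nat).
Let d := #|free_entries k l|.
Implicit Types (eps : {ffun 'I_k -> bool}).

Local Notation Zgen := (generic_matrix K k (k + l)).

Let X_ (a : 'I_d) : {mpoly K[d]} := 'X_a.

Definition chart_mx : 'M[{mpoly K[d]}]_k := cayley_den (par_skew X_) (par_low X_).

(** The chart is [Z = flip eps (cayley B P)] with [P] the adjugate of [chart_mx] divided
    by [chart_den]. *)
Definition chart_den : {mpoly K[d]} := \det chart_mx.

Definition chart_num eps : 'M[{mpoly K[d]}]_(k + l, k) :=
  flip eps (col_mx (\adj chart_mx *+ 2 - chart_den%:M)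
                   (- (par_low X_ *m \adj chart_mx) *+ 2)).

Definition chart_coord eps (i : 'I_((k + l) * k)) : {mpoly K[d]} :=
  mxvec (chart_num eps) ord0 i.

(** The chart of sign pattern [eps] covers the locus where this does not vanish. *)
Definition chart_det eps : {mpoly K[(k + l) * k]} :=
  \det (1%:M + usubmx (flip eps Zgen)).

Section Eval.
Variables (C : comNzRingType) (iota : {rmorphism K -> C}).

Lemma map_generic (v : 'I_((k + l) * k) -> C) :
  map_mx (mmap iota v) Zgen = vec_mx (\row_i v i).
Proof. by apply/matrixP => i j; rewrite !mxE mmapX mmap1U. Qed.

Lemma mmap_chart_det eps v :
  mmap iota v (chart_det eps) = \det (1%:M + usubmx (flip eps (vec_mx (\row_i v i)))).
Proof.
by rewrite /chart_det -det_map_mx map_mxD map_mx1 map_usubmx map_flip map_generic.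
Qed.

Lemma mmap_equation v i j :
  mmap iota v ((Zgen^T *m Zgen - 1%:M) i j) =
  ((vec_mx (\row_i v i))^T *m vec_mx (\row_i v i) - 1%:M) i j.
Proof.
rewrite -map_generic map_trmx -map_mxM -(map_mx1 (mmap iota v)) -map_mxB.
by rewrite [RHS]mxE.
Qed.

Variable x : 'I_d -> C.
Let M := cayley_den (par_skew x) (par_low x).

Lemma map_par_low : map_mx (mmap iota x) (par_low X_) = par_low x.
Proof.
rewrite map_dsubmx (map_par_mx (x' := x)) // => a /=.
by rewrite mmapX mmap1U.
Qed.

Lemma map_chart_mx : map_mx (mmap iota x) chart_mx = M.
Proof.
rewrite /chart_mx /cayley_den !map_mxD map_mx1 map_mxM map_mxN -!map_trmx map_par_low.
rewrite map_usubmx (map_par_mx (x' := x)) // => a /=.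
by rewrite mmapX mmap1U.
Qed.

Lemma mmap_chart_den : mmap iota x chart_den = \det M.
Proof. by rewrite -det_map_mx map_chart_mx. Qed.

Lemma chart_eval eps w (P := w *: \adj M) :
  w * mmap iota x chart_den = 1 ->
  M *m P = 1%:M /\
  \row_i (w * mmap iota x (chart_coord eps i)) =
    mxvec (flip eps (cayley (par_low x) P)).
Proof.
rewrite mmap_chart_den => wM.
split; first by rewrite -scalemxAr mul_mx_adj scale_scalar_mx wM.
have -> : cayley (par_low x) P = w *: map_mx (mmap iota x)
    (col_mx (\adj chart_mx *+ 2 - chart_den%:M) (- (par_low X_ *m \adj chart_mx) *+ 2)).
  rewrite map_col_mx scale_col_mx map_mxB !raddfMn /= map_mxN map_mxM map_mx_adj.
  rewrite map_scalar_mx /= mmap_chart_den map_chart_mx map_par_low.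
  rewrite scalerBr scale_scalar_mx wM -!scalerMnr scalerN scalemxAr.
  by [].
rewrite flipZ -map_flip -/(chart_num eps).
apply/rowP => i; rewrite mxE /chart_coord.
by rewrite linearZ /= -map_mxvec [RHS]mxE [in RHS]mxE.
Qed.

(** The determinant identity is [(1 + X) M = 2] for the flipped top block [X], so the
    chart lands where [chart_det eps] is invertible. *)
Lemma chart_point_stiefel eps w : w * mmap iota x chart_den = 1 ->
  let Z := vec_mx (\row_i (w * mmap iota x (chart_coord eps i))) : 'M_(k + l, k) in
  Z^T *m Z = 1%:M /\
  \det M * \det (1%:M + usubmx (flip eps Z)) = 2 ^+ k.
Proof.
move=> wM; have [MP ->] := chart_eval eps wM; rewrite /= mxvecK; split.
  by rewrite flip_gram; apply: cayley_stiefel MP; apply: par_skewT.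
by rewrite flipK cayley_top -det_mulmx mulmxnAr MP -scaler_nat scalemx1 det_scalar.
Qed.

Lemma chart_inverse eps w : w * mmap iota x chart_den = 1 ->
  let Z := flip eps (vec_mx (\row_i (w * mmap iota x (chart_coord eps i)))) : 'M_(k + l, k) in
  let Q := 1%:M + usubmx Z in let YA := dsubmx Z *m \adj Q in
  (\det Q *: \adj Q) *+ 2 - (\det Q ^+ 2)%:M - YA^T *m YA = \det Q ^+ 2 *: par_skew x
  /\ - (\det Q *: YA) = \det Q ^+ 2 *: par_low x.
Proof.
move=> wM; have [MP ->] := chart_eval eps wM; rewrite /= mxvecK flipK cayley_top.
set P := w *: _ in MP *; set Q := P *+ 2; set q := \det Q; set B := par_low x.
have adjQ : \adj Q *+ 2 = q *: M.
  rewrite -[LHS]mulmx1 -[X in _ *m X](mulmx1C MP) mulmxnAl -mulmxnAr -mulmxnAl.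
  by rewrite -/Q mulmxA mul_adj_mx mul_scalar_mx.
have -> : dsubmx (cayley B P) *m \adj Q = - (q *: B).
  rewrite col_mxKd mulmxnAl -mulNmx -mulmxA -mulmxnAr -mulmxnAl.
  by rewrite mul_mx_adj mul_mx_scalar scalerN.
split; last by rewrite scalerN opprK scalerA expr2.
have -> : (- (q *: B))^T *m - (q *: B) = q ^+ 2 *: (B^T *m B).
  rewrite [(- _)^T]linearN /= mulNmx mulmxN opprK [(_ *: _)^T]linearZ /=.
  by rewrite -scalemxAl -scalemxAr scalerA expr2.
rewrite scalerMnr adjQ scalerA -expr2 -[(_ ^+ 2)%:M]scalemx1 -!scalerBr.
by congr (_ *: _); rewrite /M /cayley_den addrAC addrK addrAC subrr add0r.
Qed.

End Eval.

(** Holds over any algebra, not just over the ground field: at field points it says that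
    the charts cover the variety, at the generic point of the localized coordinate ring
    it shows that this ring has no nilpotents. *)
Lemma chart_surj eps (C : comNzRingType) (iota : {rmorphism K -> C}) (half t : C)
    (Z : 'M[C]_(k + l, k)) :
  half * 2 = 1 -> Z^T *m Z = 1%:M ->
  t * \det (1%:M + usubmx (flip eps Z)) = 1 ->
  exists x w, w * mmap iota x chart_den = 1 /\
    \row_i (w * mmap iota x (chart_coord eps i)) = mxvec Z.
Proof.
move=> half2 ZZ; set Q := 1%:M + _ => tQ.
have WQ : (t *: \adj Q) *m Q = 1%:M.
  by rewrite -scalemxAl mul_adj_mx scale_scalar_mx tQ.
have XY : (usubmx (flip eps Z))^T *m usubmx (flip eps Z) +
          (dsubmx (flip eps Z))^T *m dsubmx (flip eps Z) = 1%:M.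
  by rewrite -gram_col_mx vsubmxK flip_gram.
have [Hskew MP ZE] := inv_cayley half2 XY WQ.
set H := _ - _ - _ in Hskew MP; set B := - _ in MP ZE; set P := half *: _ in MP ZE.
have [x [Hx Bx]] := par_surj B half2 Hskew.
pose w := \det P.
have wM : w * mmap iota x chart_den = 1.
  by rewrite mmap_chart_den Hx Bx mulrC -det_mulmx MP det1.
exists x, w; split=> //.
have [MP' ->] := chart_eval eps wM; rewrite Hx Bx in MP' *.
set P' := w *: _ in MP' *.
have -> : P' = P.
  by rewrite -[P']mul1mx -(mulmx1C MP) -mulmxA MP' mulmx1.
by rewrite ZE vsubmxK flipK.
Qed.

End Charts.

Section InverseNumerator.
Variables (k l : nat).

(** The inverse Cayley transform [(H, B)] multiplied by [det (1 + X) ^+ 2], which makes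
    its entries polynomial in those of [Z]. *)
Definition cayley_inv_num (C : comNzRingType) (Z : 'M[C]_(k + l, k)) : 'M[C]_(k + l, k) :=
  let Q := 1%:M + usubmx Z in let YA := dsubmx Z *m \adj Q in
  col_mx ((\det Q *: \adj Q) *+ 2 - (\det Q ^+ 2)%:M - YA^T *m YA) (- (\det Q *: YA)).

Lemma map_cayley_inv_num (C C' : comNzRingType) (f : {rmorphism C -> C'})
    (Z : 'M[C]_(k + l, k)) :
  map_mx f (cayley_inv_num Z) = cayley_inv_num (map_mx f Z).
Proof.
rewrite /cayley_inv_num !mulr2n map_col_mx !map_mxD !map_mxN !map_mxZ !map_mxM map_scalar_mx.
rewrite -map_trmx !map_mxM rmorphXn /= map_mx_adj map_mxD map_mx1 map_usubmx map_dsubmx.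
by rewrite -det_map_mx map_mxD map_mx1 map_usubmx.
Qed.

End InverseNumerator.

(** * The Stiefel variety *)

Section StiefelGeometry.
Variables (K : closedFieldType) (k l : nat).
Hypothesis natr_inj : injective (fun n : nat => n%:R : K).

Local Notation Zgen := (generic_matrix K k (k + l)).
Let V : set 'rV[K]_((k + l) * k) := stiefel K k (k + l).
Let D := chart_den K k l.
Let chart (eps : {ffun 'I_k -> bool}) := rat_image D (@chart_coord K k l eps).
Let equations := stiefel_equations K k (k + l).

Lemma two_neq0 : (2 : K) != 0.
Proof. by apply/eqP => /(natr_inj (x1 := 2) (x2 := 0)). Qed.

Lemma row_entries n (C : Type) (x : 'rV[C]_n) : \row_i x ord0 i = x.
Proof. by apply/rowP => i; rewrite mxE. Qed.

Lemma zero_locus_equations : zero_locus equations = V.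
Proof.
have eqE (x : 'rV[K]_((k + l) * k)) i j :
    ((Zgen^T *m Zgen - 1%:M) i j).@[x ord0] = ((vec_mx x)^T *m vec_mx x - 1%:M) i j.
  by have := mmap_equation (@idfun K) (x ord0) i j; rewrite row_entries.
apply/seteqP; split=> x.
  move=> Ex; apply/eqP; rewrite -subr_eq0; apply/eqP/matrixP => i j.
  by rewrite [RHS]mxE -eqE; apply: Ex; exists i, j.
by move=> Vx p [i [j ->]]; rewrite eqE Vx subrr mxE.
Qed.

Lemma stiefel_algebraic : algebraic V.
Proof. by exists equations; rewrite zero_locus_equations. Qed.

Lemma chart_sub eps : chart eps `<=` V.
Proof.
move=> _ [x [Dx ->]]; have DV : D.@[x]^-1 * mmap (@idfun K) x D = 1 by rewrite mulVf.
exact: (chart_point_stiefel eps DV).1.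
Qed.

Lemma meval_chart_det eps (y : 'rV[K]_((k + l) * k)) :
  (chart_det K l eps).@[y ord0] = \det (1%:M + usubmx (flip eps (vec_mx y))).
Proof. by have := mmap_chart_det (@idfun K) eps (y ord0); rewrite row_entries. Qed.

Lemma chart_det_neq0 eps y : chart eps y -> (chart_det K l eps).@[y ord0] != 0.
Proof.
case=> x [Dx ->]; have DV : D.@[x]^-1 * mmap (@idfun K) x D = 1 by rewrite mulVf.
rewrite meval_chart_det; have := (chart_point_stiefel eps DV).2 => /= /eqP; apply: contraTN => /eqP.
rewrite /rat_map => ->; rewrite mulr0 eq_sym expf_eq0 (negPf two_neq0) andbF //.
Qed.

Lemma chart_cover eps y : V y -> (chart_det K l eps).@[y ord0] != 0 -> chart eps y.
Proof.
move=> Vy; rewrite meval_chart_det => dy.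
have [x [w [wD yE]]] := chart_surj (@idfun K) (mulVf two_neq0) Vy (mulVf dy).
have Dx : D.@[x] != 0.
  by apply/eqP => D0; move/eqP: wD; rewrite [mmap _ _ _]D0 mulr0 eq_sym oner_eq0.
exists x; split=> //; rewrite -[y]vec_mxK -yE.
apply/rowP => i; rewrite !mxE; congr (_ * _); apply: (mulIf Dx).
by rewrite mulVf.
Qed.

Lemma sum_chart_det : \sum_(eps : {ffun 'I_k -> bool}) chart_det K l eps = (2 ^+ k)%:MP.
Proof.
rewrite /chart_det; under eq_bigr do rewrite col_mxKu.
by rewrite sum_det_flip rmorphXn /= rmorph_nat.
Qed.

Lemma exists_chart_det (y : 'rV[K]_((k + l) * k)) :
  exists eps, (chart_det K l eps).@[y ord0] != 0.
Proof.
apply: contrapT => h; have /eqP := congr1 (meval (y ord0)) sum_chart_det.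
rewrite mevalC raddf_sum big1 => [|eps _]; last first.
  by apply/eqP/negPn/negP => e; apply: h; exists eps.
by rewrite eq_sym expf_eq0 (negPf two_neq0) andbF.
Qed.

Lemma chart_den0 : D.@[fun=> 0] != 0.
Proof.
have -> : D.@[fun=> 0] = 1; last exact: oner_neq0.
rewrite [LHS](mmap_chart_den (@idfun K)).
have p0 : par_mx (fun=> 0 : K) = 0 :> 'M_(k + l, k).
  by apply/matrixP => i j; rewrite !mxE big1.
by rewrite /cayley_den /par_skew /par_low p0 [usubmx 0]linear0 [dsubmx 0]linear0
  trmx0 subr0 mulmx0 !addr0 det1.
Qed.

Lemma chart_den_neq0 : D != 0.
Proof. by apply: contra_neq chart_den0 => ->; rewrite meval0. Qed.

Lemma stiefel_has_dim : has_dim V #|free_entries k l|.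
Proof.
split; last first.
  apply: chain_length_le => // z Vz; have [eps dz] := exists_chart_det z.
  exists D, (chart_coord K eps), (chart_det K l eps); split=> // y; exact: chart_cover.
pose eps0 : {ffun 'I_k -> bool} := [ffun=> false].
pose G := cayley_inv_num (flip eps0 Zgen).
apply: (chain_exists natr_inj (D := D) (u := chart_coord K eps0)
  (g := fun a => G (enum_val a).1 (enum_val a).2))
  stiefel_algebraic (@chart_sub eps0) chart_den0 _.
move=> x a Dx; have DV : D.@[x]^-1 * mmap (@idfun K) x D = 1 by rewrite mulVf.
set y := rat_map _ _ x.
have -> : (G (enum_val a).1 (enum_val a).2).@[y ord0] =
    (chart_det K l eps0).@[y ord0] ^+ 2 * x a.
  have := map_generic (@idfun K) (y ord0); rewrite row_entries => gE.
  transitivity (map_mx (mmap (@idfun K) (y ord0)) G (enum_val a).1 (enum_val a).2).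
    by rewrite [RHS]mxE.
  rewrite /G map_cayley_inv_num map_flip gE meval_chart_det /cayley_inv_num.
  have [-> ->] := chart_inverse eps0 DV.
  by rewrite -scale_col_mx [LHS]mxE par_colE.
have dy : (chart_det K l eps0).@[y ord0] ^+ 2 != 0.
  by rewrite expf_neq0 // chart_det_neq0 //; exists x.
by split=> [/eqP|->]; rewrite ?mulr0 // mulf_eq0 (negPf dy) => /eqP.
Qed.

(** A polynomial [p] vanishing on the variety pulls back to 0 on each chart. The generic
    solution of the equations over the localization at [chart_det eps] lies on that chart
    too, so [p] is 0 there and a power of [chart_det eps] times [p] lies in the ideal of
    the equations. The [chart_det eps] sum up to the invertible constant [2 ^+ k]. *)
Lemma stiefel_ideal : vanishing_ideal V = ideal_span equations.
Proof.
apply/seteqP; split=> [p Ip|]; last first.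
  apply: ideal_span_min => [|p q|a p|p Ep y].
  - exact: vanishing_ideal0.
  - exact: vanishing_idealD.
  - exact: vanishing_idealM.
  - by rewrite -zero_locus_equations; apply.
have [M] : exists M, ideal_span equations
    ((\sum_(eps : {ffun 'I_k -> bool}) chart_det K l eps) ^+ M * p).
  apply: colon_radical_sum => eps; apply: localization_principle => C g t tg gS.
  pose iota : {rmorphism K -> C} := g \o @mpolyC _ K.
  pose v i := g 'X_i.
  have gE q : g q = mmap iota v q by rewrite -[q in LHS]mmap_id rmorph_mmap.
  pose Z : 'M[C]_(k + l, k) := vec_mx (\row_i v i).
  have ZZ : Z^T *m Z = 1%:M.
    apply/eqP; rewrite -subr_eq0; apply/eqP/matrixP => i j.
    by rewrite -(mmap_equation iota) -gE [RHS]mxE; apply: gS; exists i, j.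
  rewrite gE mmap_chart_det -/Z in tg.
  have half2 : iota 2^-1 * 2 = 1.
    by rewrite -[2 in X in _ * X](rmorph_nat iota) -rmorphM mulVf ?rmorph1 // two_neq0.
  have [x [w [wD vE]]] := chart_surj iota half2 ZZ tg.
  have pb0 : pullback D (chart_coord K eps) p = 0.
    apply/(vanishing_rat_image _ natr_inj chart_den_neq0).
    exact: vanishing_idealS (@chart_sub eps) _ Ip.
  have := mmap_pullback (chart_coord K eps) p wD.
  rewrite pb0 rmorph0 => /(congr1 ( *%R (w ^+ msize p))).
  rewrite mulr0 mulrA -exprMn wD expr1n mul1r gE => ->.
  apply: eq_mmap => // i; have /rowP/(_ i) := vE.
  by rewrite mxE vec_mxK mxE.
rewrite sum_chart_det -rmorphXn /= => /(ideal_spanM ((2 ^+ k) ^- M)%:MP).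
by rewrite mulrA -mpolyCM mulVf ?mul1r // !expf_neq0 // two_neq0.
Qed.

Section Irreducibility.
Hypothesis l_gt0 : (0 < l)%N.

(** The top block is diagonal with entries [eps j], except for a 0 in position [i] that
    is compensated by a 1 in the bottom block; this needs a bottom row. *)
Lemma common_point (eps : {ffun 'I_k -> bool}) i :
  exists2 z, V z & forall eta : {ffun 'I_k -> bool},
    (forall j, j != i -> eta j = eps j) -> (chart_det K l eta).@[z ord0] != 0.
Proof.
pose X : 'M[K]_k := diag_mx (\row_j (if j == i then 0 else (-1) ^+ eps j)).
pose Y : 'M[K]_(l, k) := delta_mx (Ordinal l_gt0) i.
exists (mxvec (col_mx X Y)).
  rewrite /V /stiefel /= mxvecK gram_col_mx tr_diag_mx mulmx_diag trmx_delta mul_delta_mx.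
  apply/matrixP => a b; rewrite !mxE.
  have [->|ab] := eqVneq a b; last first.
    rewrite mulr0n add0r; case: eqP => [ai|//]; case: eqP => [bi|//].
    by rewrite ai bi eqxx in ab.
  rewrite mulr1n andbb; have [_|_] := eqVneq b i; first by rewrite mulr0 add0r.
  by rewrite -signr_addb addbb addr0.
move=> eta etaE; rewrite meval_chart_det mxvecK col_mxKu col_mxKu mulmx_diag.
rewrite -diag_const_mx -linearD det_diag prodf_seq_neq0; apply/allP => j _ /=.
rewrite !mxE; have [_|ji] := eqVneq j i; first by rewrite mulr0 addr0 oner_eq0.
by rewrite etaE // -signr_addb addbb; apply: two_neq0.
Qed.

(** Charts whose signs differ in one place meet, and both have prime ideals, so they have
    the same closure; any two sign patterns are joined by such steps. *)
Lemma vanishing_chart_sub eps eta :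
  vanishing_ideal (chart eps) `<=` vanishing_ideal (chart eta).
Proof.
have step (eps1 eps2 : {ffun 'I_k -> bool}) i : (forall j, j != i -> eps2 j = eps1 j) ->
    vanishing_ideal (chart eps1) `<=` vanishing_ideal (chart eps2).
  move=> e12 p Ip; have [z Vz dz] := common_point eps1 i.
  have /prime_idealP[_ _ _ _ IP] :=
    prime_rat_image (chart_coord K eps2) natr_inj chart_den_neq0.
  have [||//] := IP (chart_det K l eps1) p.
    move=> y /(@chart_sub eps2) Vy; rewrite mevalM.
    have [->|dy] := eqVneq (chart_det K l eps1).@[y ord0] 0; first by rewrite mul0r.
    by rewrite Ip ?mulr0 //; apply: chart_cover.
  have z2 : chart eps2 z by apply: chart_cover Vz _; apply: dz.
  by move=> /(_ z z2) dz0; case/eqP: (dz eps1 (fun _ _ => erefl)).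
pose mix m : {ffun 'I_k -> bool} := [ffun i : 'I_k => if (i < m)%N then eta i else eps i].
have -> : eta = mix k by apply/ffunP => i; rewrite ffunE ltn_ord.
suff mixP m : (m <= k)%N ->
    vanishing_ideal (chart eps) `<=` vanishing_ideal (chart (mix m)).
  exact: mixP.
elim: m => [_|m IH mk].
  by have -> : mix 0%N = eps by apply/ffunP => i; rewrite ffunE.
apply: subset_trans (IH (ltnW mk)) _; apply: (step _ _ (Ordinal mk)) => j jm.
rewrite !ffunE ltnS leq_eqVlt; case: eqP => // jm'.
by case/eqP: jm; apply: val_inj.
Qed.

Lemma prime_stiefel : prime_ideal (vanishing_ideal V).
Proof.
pose eps0 : {ffun 'I_k -> bool} := [ffun=> false].
have -> : vanishing_ideal V = vanishing_ideal (chart eps0).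
  apply/seteqP; split; first exact/vanishing_idealS/chart_sub.
  move=> p Ip y Vy; have [eps dy] := exists_chart_det y.
  exact: (vanishing_chart_sub Ip (chart_cover Vy dy)).
exact: prime_rat_image natr_inj chart_den_neq0.
Qed.

Lemma irreducible_stiefel : irreducible V.
Proof. exact: prime_irreducible stiefel_algebraic prime_stiefel. Qed.

End Irreducibility.

(** By symmetry of the Gram matrix one equation per pair [j <= i] is enough. These pairs
    are the complement of the free entries, which is why the count matches. *)
Lemma stiefel_complete_intersection : complete_intersection (vanishing_ideal V).
Proof.
pose E i j := (Zgen^T *m Zgen - 1%:M) i j.
have Esym i j : E i j = E j i.
  by rewrite /E -[in LHS](trmxK (_ - _)) linearB /= trmx1 trmx_mul trmxK mxE.
pose T := ~: free_entries k l.
pose top (i : 'I_(k + l)) (j : 'I_k) : 'I_k := if split i is inl i' then i' else j.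
exists #|T|, #|free_entries k l|,
  (fun a => E (top (enum_val a).1 (enum_val a).2) (enum_val a).2).
split; last by rewrite addnC cardsC card_prod !card_ord.
  rewrite stiefel_ideal; apply/seteqP; split; apply: ideal_span_min.
  - exact: ideal_span0.
  - exact: ideal_spanD.
  - exact: ideal_spanM.
  - move=> p [i [j ->]]; apply: ideal_span_gen; rewrite -/(E i j).
    wlog ji : i j / (j <= i)%N.
      by move=> h; case: (leqP j i) => [|/ltnW] /h //; rewrite Esym.
    have ijT : (lshift l i, j) \in T by rewrite finset.in_setC free_top -leqNgt.
    exists (enum_rank_in ijT (lshift l i, j)) => //.
    by rewrite enum_rankK_in //= /top -[lshift l i]/(unsplit (inl i)) unsplitK.
  - exact: ideal_span0.
  - exact: ideal_spanD.
  - exact: ideal_spanM.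
  - move=> p [a _ <-]; apply: ideal_span_gen; rewrite /E.
    by exists (top (enum_val a).1 (enum_val a).2), (enum_val a).2.
by rewrite [zero_locus _](algebraic_closure stiefel_algebraic); apply: stiefel_has_dim.
Qed.

End StiefelGeometry.

(** * Binomial identities *)

Lemma card_free_entries k l : #|free_entries k l| = ((k + l) * k - 'C(k.+1, 2))%N.
Proof.
have -> : ((k + l) * k = #|free_entries k l| + #|~: free_entries k l|)%N.
  by rewrite cardsC card_prod !card_ord.
suff -> : #|~: free_entries k l| = 'C(k.+1, 2) by rewrite addnK.
transitivity (\sum_(i < k + l) \sum_(j < k | (i, j) \notin free_entries k l) 1)%N.
  by rewrite -sum1_card pair_big_dep; apply: eq_bigl => -[i j]; rewrite finset.in_setC.
rewrite big_split_ord /= [X in (_ + X)%N]big1 ?addn0; last first.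
  by move=> i _; rewrite big_pred0 // => j; rewrite free_bottom.
transitivity (\sum_(i < k) i.+1)%N.
  apply: eq_bigr => i _; rewrite -[RHS]card_ord -sum1_card.
  rewrite (big_ord_widen_leq k xpredT (fun=> 1%N)) //.
  by apply: eq_bigl => j; rewrite free_top -leqNgt.
by elim: k {l} => [|k IH]; rewrite ?big_ord0 // big_ord_recr /= IH [RHS]binS bin1 addnC.
Qed.

Lemma bin2_dim k l :
  ((k + l) * k - 'C(k.+1, 2) = 'C(k + l, 2) - 'C(l, 2))%N.
Proof.
have sq m : (m * m = 2 * 'C(m, 2) + m)%N.
  by elim: m => // m IH; rewrite binS bin1; lia.
have bD m : ('C(m + l, 2) = 'C(m, 2) + 'C(l, 2) + m * l)%N.
  elim: m => [|m IH]; first by rewrite !add0n mul0n addn0.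
  by rewrite addSn !binS !bin1; lia.
by rewrite bD binS bin1 mulnDl sq; lia.
Qed.

Theorem theorem2p3 (R : realType) (k n : nat) (hk : (1 <= k)%N) (hkn : (k <= n)%N) :
  let V := stiefel R[i] k n in
  let I := vanishing_ideal V in
  [/\ has_dim V (n * k - 'C(k.+1, 2))%N,
      (n * k - 'C(k.+1, 2) = 'C(n, 2) - 'C(n - k, 2))%N,
      I = ideal_span (stiefel_equations R[i] k n),
      complete_intersection I
    & (k < n)%N -> irreducible V /\ prime_ideal I].
Proof.
have natr_inj : injective (fun m : nat => m%:R : R[i]).
  by move=> a b /eqP; rewrite eqr_nat => /eqP.
have [l ->] : exists l, n = (k + l)%N by exists (n - k)%N; rewrite subnKC.
move=> V I; split.
- by rewrite -card_free_entries; apply: stiefel_has_dim.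
- by rewrite addKn bin2_dim.
- exact: stiefel_ideal.
- exact: stiefel_complete_intersection.
- rewrite -[X in (X < _)%N]addn0 ltn_add2l => l0.
  by split; [apply: irreducible_stiefel | apply: prime_stiefel].
Qed.
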